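(* Let $N\in[1,\infty)$ and let $(X,d,m)$ be a noncompact, non-branching $\mathrm{MCP}(0,N)$ space. Let $\gamma:[0,\infty)\to X$ be a geodesic ray, $p=\gamma(0)$, let $b$ be the Busemann function associated to $\gamma$, and suppose that $(X,d,m)$ has minimal volume growth, i.e. $$\limsup_{R\to\infty}\frac{m(B_p(R))}{R}=V_0<\infty .$$ Then there is a constant $C_0\le2$ such that $$\limsup_{R\to+\infty}\frac{\mathrm{diam}(b^{-1}(R))}{R}\le C_0\le 2,$$ where the diameter of $b^{-1}(R)$ is computed with respect to $d$. In particular, $b^{-1}(r)$ is compact for every $r$.
   Context: A metric measure space $(X,d,m)$ means: $(X,d)$ is a complete separable geodesic metric space, $m$ is a nonnegative Radon measure, finite on bounded sets, with $\mathrm{supp}(m)=X$. $\mathrm{Geo}(X)$ is the set of (constant speed, length minimizing) geodesics $[0,1]\to X$ with the uniform topology, and $e_t(\eta)=\eta(t)$. $\mathrm{MCP}(0,N)$: for every $x\in X$ and every $m$-measurable $A\subset X$ with $m(A)\in(0,\infty)$ there is a Borel probability measure $\Xi$ on $\mathrm{Geo}(X)$ with $(e_t)_*\Xi\in\mathcal P_2(X)$ for all $t$, $(e_0)_*\Xi=\delta_x$, $(e_1)_*\Xi=\frac1{m(A)}m|_A$ and $m\ge (e_t)_*(t^N m(A)\,\Xi)$ as measures for every $t\in[0,1]$. $(X,d)$ is non-branching if any two geodesics $\gamma^1,\gamma^2:[0,1]\to X$ that coincide on some (nondegenerate) interval $I\subset[0,1]$ coincide on $[0,1]$. A geodesic ray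 is a map $\gamma:[0,\infty)\to X$ with $d(\gamma(s),\gamma(t))=|s-t|$ for all $s,t\ge0$. Its Busemann function is $b(x)=\lim_{t\to+\infty}(t-d(x,\gamma(t)))$. $B_p(R)$ is the ball of radius $R$ centred at $p$. *)

(* Defs.v *)
From HB Require Import structures.
From mathcomp Require Import all_boot all_order all_algebra.
From mathcomp Require Import all_classical all_reals all_analysis.

Set Implicit Arguments.
Unset Strict Implicit.
Unset Printing Implicit Defensive.

Import Order.TTheory GRing.Theory Num.Theory.
Import numFieldNormedType.Exports.

Local Open Scope classical_set_scope.
Local Open Scope ring_scope.
Local Open Scope ereal_scope.

#[short(type="completeMetricType")]
HB.structure Definition CompleteMetric (R : numDomainType) :=
  {T of Complete T & Metric R T}.

Notation borel T := (g_sigma_algebraType (@open T)).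

Definition is_geodesic (R : realType) (X : completeMetricType R)
    (g : {i01 R} -> X) : Prop :=
  forall s t : {i01 R},
    mdist (g s) (g t) =
    (`|s%:num - t%:num| * mdist (g 0%:i01) (g 1%:i01))%R.

Definition geo (R : realType) (X : completeMetricType R) : Type :=
  set_type [set g : {uniform {i01 R} -> X} | is_geodesic g].

HB.instance Definition _ (R : realType) (X : completeMetricType R) :=
  Topological.copy (geo X)
    (set_type [set g : {uniform {i01 R} -> X} | is_geodesic g]).

Lemma is_geodesic_cst (R : realType) (X : completeMetricType R) (x : X) :
  is_geodesic (fun=> x).
Proof. by move=> s t; rewrite !mdistxx mulr0. Qed.

(* The library's measurable types are pointed; the base point is irrelevant. *)
HB.instance Definition _ (R : realType) (X : completeMetricType R) :=
  isPointed.Build (geo X)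
    (exist _ (fun=> point : X) (mem_set (is_geodesic_cst (point : X)))).

Definition evalg (R : realType) (X : completeMetricType R) (t : {i01 R})
  (g : geo X) : X := set_val g t.

Definition separable_space (X : topologicalType) : Prop :=
  exists2 D : set X, countable D & dense D.

Definition geodesic_space (R : realType) (X : completeMetricType R) : Prop :=
  forall x y : X, exists g : geo X,
    evalg 0%R%:i01 g = x /\ evalg 1%R%:i01 g = y.

Definition nonbranching (R : realType) (X : completeMetricType R) : Prop :=
  forall g1 g2 : geo X,
    (exists I : set R,
      [/\ is_interval I,
          exists a b : R, [/\ I a, I b & (a < b)%R],
          (forall s, I s -> (0 <= s <= 1)%R) &
          forall t : {i01 R}, I t%:num -> evalg t g1 = evalg t g2]) ->
    forall t : {i01 R}, evalg t g1 = evalg t g2.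

Section measures.
Context (R : realType) (X : completeMetricType R).
Implicit Types (m : {measure set (borel X) -> \bar R}).

Definition radon m : Prop :=
  (forall x : X, exists2 U : set X, open_nbhs x U & m U < +oo) /\
  (forall B : set (borel X), measurable B ->
    m B = ereal_sup [set m K | K in [set K : set X | compact K /\ K `<=` B]]).

Definition finite_on_bounded m : Prop :=
  forall B : set (borel X), measurable B ->
    (exists (x : X) (r : R), (B : set X) `<=` ball x r) -> m B < +oo.

Definition supp m : set X :=
  [set x | forall U : set X, open_nbhs x U -> 0 < m U].

Definition metric_measure_space m : Prop :=
  [/\ separable_space X, geodesic_space X, radon m, finite_on_bounded m &
      supp m = setT].

Definition P2 (mu : set (borel X) -> \bar R) : Prop :=
  mu setT = 1 /\
  exists x0 : X, \int[mu]_(x in setT) ((mdist x0 x) ^+ 2)%:E < +oo.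

Definition marginal (Xi : set (borel (geo X)) -> \bar R) (t : {i01 R}) :
    set (borel X) -> \bar R :=
  pushforward Xi (evalg t : borel (geo X) -> borel X).

(* The m-measurable sets are the Caratheodory-measurable sets of the outer
   measure m^* induced by m. As m is sigma-finite, they form the completion of
   the Borel sigma-algebra, and m^* is the completed measure on them. *)
Definition normalized_restr m (A : set X) (B : set (borel X)) : \bar R :=
  (m^*%mu A)^-1 * m^*%mu (A `&` B).

(* The measure normalized_restr m A is the image of Xi by evalg 1, so the images
   of Xi can all lie in P2 only if normalized_restr m A does. On a noncompact
   space there are unbounded A of finite positive measure for which it does not
   (m has infinite mass and no atoms). Hence the P2 requirement is conditional:
   asked of every A it would be a stronger property, which no noncompact space
   has. For t < 1 it follows from t = 1, since Xi-almost every geodesic g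
   satisfies mdist x (g t) = t * mdist x (g 1). *)
Definition MCP0 m (N : R) : Prop :=
  forall (x : X) (A : set X),
    (m^*)%mu.-cara.-measurable A ->
    0 < m^*%mu A < +oo ->
    exists Xi : probability (borel (geo X)) R,
      [/\ P2 (normalized_restr m A) ->
            forall t : {i01 R}, P2 (marginal Xi t),
          forall B : set (borel X), measurable B ->
            marginal Xi 0%R%:i01 B = \d_(x : borel X) B,
          forall B : set (borel X), measurable B ->
            marginal Xi 1%R%:i01 B = normalized_restr m A B &
          forall (t : {i01 R}) (B : set (borel X)), measurable B ->
            marginal (fun G => (t%:num `^ N)%:E * m^*%mu A * Xi G) t B
              <= m B].

End measures.

Definition geodesic_ray (R : realType) (X : completeMetricType R)
    (gamma : R -> X) : Prop :=
  forall s t : R, (0 <= s)%R -> (0 <= t)%R ->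
    mdist (gamma s) (gamma t) = `|s - t|%R.

Definition busemann (R : realType) (X : completeMetricType R)
    (gamma : R -> X) (x : X) : R :=
  lim ((t - mdist x (gamma t))%R @[t --> +oo%R]).

(* The diameter of the empty set is -oo. *)
Definition diam (R : realType) (X : completeMetricType R) (A : set X) :
    \bar R :=
  ereal_sup [set (mdist x y)%:E | x in A & y in A].

(* Main.v *)
Require Import Defs.
From mathcomp Require Import all_boot all_order all_algebra.
From mathcomp Require Import all_classical all_reals all_analysis.
From mathcomp Require Import ring lra.

(** Write b for the Busemann function of gamma and p for gamma(0). The proof
    follows the volume upwards along b.

    Contract a bounded set towards gamma(T), moving its points by a distance of
    about s. By MCP(0,N) the volume shrinks at most by the factor
    (1 - s / T)^N, and b rises by about s, because T - d(x, gamma(T)) tends to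
    b(x) from below. With T tending to infinity, the part of the slab
    lo <= b <= hi within distance rho of p has at most the volume of the part of
    lo + s <= b <= hi + s within distance rho + s of p (vol_slab_shift).

    Stacking such translates disjointly inside a ball about p gives a linear
    lower bound for the volume of balls (vol_cball_ge_linear) and, together with
    the linear upper bound, a common bound for the volumes of all slabs of
    height one (vol_slab_bounded). Take a bounded piece of such a slab whose
    volume is within e of the supremum, at distance at most rho0 from p. Its
    translate by s still has that volume and lies within distance rho0 + s of p,
    so only volume e is left in the rest of the slab reached
    (vol_slab_tail_small).

    Now let b(x) = r be large and d(p,x) >= (1 + 3 delta) r. If moreover
    d(p,x) <= 11 r, the ball of radius delta r about x lies in these nearly
    empty remainders, so its volume is at most of order e r; contracting a ball
    of radius 22 r to x shows that it is at least c(delta) r. For e small this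
    is absurd (drift_gap). A point x further away is first moved along a
    geodesic to a remote point of the ray: b then grows at almost unit speed and
    d(p,.) - b decreases at most at speed 2, so the excluded range is met
    (drift_sublinear).

    Hence b^-1(r) lies in the ball of radius (1 + 3 delta) r about p once r is
    large, which is the bound on the diameter. Moving a low level set up into a
    high one shows that every level set is bounded, and closed bounded sets are
    compact because contraction bounds the number of disjoint small balls in a
    given ball. *)

Set Implicit Arguments.
Unset Strict Implicit.
Unset Printing Implicit Defensive.

Import Order.TTheory GRing.Theory Num.Theory.
Import numFieldNormedType.Exports.

Local Open Scope classical_set_scope.
Local Open Scope ring_scope.

(** * Contraction along geodesics *)

Section geodesics.
Context (R : realType) (X : completeMetricType R).
Implicit Types (x y z : X) (t : {i01 R}).

Lemma evalg_continuous t : continuous (evalg t : geo X -> X).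
Proof.
have eval_cont : continuous (fun f : {uniform {i01 R} -> X} => f t).
  move=> f A /=; rewrite -nbhs_entourageE => -[E entE EA].
  apply/uniform_nbhs; exists E; split=> // h Eh.
  by apply: EA; apply/xsectionP; exact: Eh.
have val_cont : continuous (set_val : geo X -> {uniform {i01 R} -> X}).
  exact: initial_continuous.
move=> g; exact: (continuous_comp (val_cont g) (eval_cont (set_val g))).
Qed.

Lemma measurable_evalg t (B : set X) : measurable (B : set (borel X)) ->
  measurable (evalg t @^-1` B : set (borel (geo X))).
Proof.
move=> mB; rewrite -[X in measurable X]setTI.
apply: (@measurability _ _ (borel (geo X)) (borel X) setT (evalg t) open) => //.
move=> _ [U oU <-]; rewrite setTI; apply: sub_sigma_algebra.
by move: U oU; apply/continuousP; exact: evalg_continuous.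
Qed.

Lemma mdist_evalg (g : geo X) (s t : {i01 R}) :
  mdist (evalg s g) (evalg t g) =
  `|s%:num - t%:num| * mdist (evalg 0%:i01 g) (evalg 1%:i01 g).
Proof. by have := set_valP g; apply. Qed.

Lemma mdist_evalgl (g : geo X) t :
  mdist (evalg 0%:i01 g) (evalg t g) =
  t%:num * mdist (evalg 0%:i01 g) (evalg 1%:i01 g).
Proof. by rewrite mdist_evalg /= sub0r normrN ger0_norm. Qed.

Lemma mdist_evalgr (g : geo X) t :
  mdist (evalg t g) (evalg 1%:i01 g) =
  (1 - t%:num) * mdist (evalg 0%:i01 g) (evalg 1%:i01 g).
Proof. by rewrite mdist_evalg /= distrC ger0_norm ?subr_ge0. Qed.

Lemma geodesic_point (gX : geodesic_space X) x z (s : R) :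
  0 <= s <= mdist x z ->
  exists y, mdist x y = s /\ mdist y z = mdist x z - s.
Proof.
move=> /andP[s0 sd].
have [d0|d0] := eqVneq (mdist x z) 0.
  have {}s0 : s = 0 by lra.
  by exists x; rewrite mdistxx s0 subr0.
have [g [g0 g1]] := gX x z.
have dgt0 : 0 < mdist x z by rewrite lt_neqAle eq_sym d0 mdist_ge0.
have t0 : 0 <= s / mdist x z by rewrite divr_ge0 ?mdist_ge0.
have t1 : s / mdist x z <= 1 by rewrite ler_pdivrMr ?mul1r.
exists (evalg (Itv01 t0 t1) g).
have := mdist_evalgl g (Itv01 t0 t1); have := mdist_evalgr g (Itv01 t0 t1).
by rewrite g0 g1 /= => -> ->; split; field.
Qed.

End geodesics.

Lemma probability_setI1 (R : realType) d (T : measurableType d)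
  (P : probability T R) (A B : set T) :
  measurable A -> measurable B -> (P A = 1 -> P B = 1 -> P (A `&` B) = 1)%E.
Proof.
move=> mA mB PA PB; have PAB : (P (A `\` B) = 0)%E.
  apply/eqP; rewrite eq_le measure_ge0 andbT.
  have -> : (0 = P (~` B))%E by rewrite probability_setC// PB subee.
  apply: le_measure; rewrite ?inE; [exact: measurableD|exact: measurableC|].
  by move=> x [].
have PAE : P A = (P (A `\` B) + P (A `&` B))%E by exact: measureDI.
by rewrite -PA PAE PAB add0e.
Qed.

Section contraction.
Context (R : realType) (N : R) (X : completeMetricType R)
  (m : {measure set (borel X) -> \bar R}).
Local Open Scope ereal_scope.

Lemma normalized_restr_self (A : set X) :
  measurable (A : set (borel X)) -> 0 < m A < +oo ->
  normalized_restr m A A = 1.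
Proof.
move=> mA /andP[A0 Aoo]; rewrite /normalized_restr setIid.
rewrite measurable_mu_extE// mulVe ?gt_eqF//.
by rewrite ge0_fin_numE// ltW.
Qed.

(** The only form in which the curvature condition is used. Almost every
    geodesic of the plan issues from x and ends in A, so its point at time t is
    in B by assumption: the plan gives B full mass at time t. *)
Lemma mcp_contraction (mcpX : MCP0 m N) (x : X) (A B : set X) (t : R) :
  (0 <= t <= 1)%R -> measurable (A : set (borel X)) ->
  measurable (B : set (borel X)) -> m A < +oo ->
  (forall a y, A a -> mdist x y = (t * mdist x a)%R ->
     mdist y a = ((1 - t) * mdist x a)%R -> B y) ->
  (t `^ N)%:E * m A <= m B.
Proof.
move=> /andP[t0 t1] mA mB Aoo AB.
have [A0|A0] := eqVneq (m A) 0; first by rewrite A0 mule0.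
have A_gt0 : 0 < m A by rewrite lt_neqAle eq_sym A0 measure_ge0.
have mA' : (m^*)%mu.-cara.-measurable A.
  by apply: sub_caratheodory; apply: sub_sigma_algebra.
have AE : m^*%mu A = m A by rewrite measurable_mu_extE.
have [|Xi [_ Xi0 Xi1 Xit]] := mcpX x A mA'; first by rewrite AE A_gt0.
have /(_ _ mB) := Xit (Itv01 t0 t1).
rewrite /marginal /pushforward AE /=.
suff -> : Xi (evalg (Itv01 t0 t1) @^-1` B) = 1 by rewrite mule1.
have cx : measurable ([set x] : set (borel X)).
  rewrite -[X in measurable X]setCK; apply: measurableC.
  apply: sub_sigma_algebra.
  apply: closed_openC; apply: accessible_closed_set1.
  by apply: hausdorff_accessible; exact: metric_hausdorff.
have e0 : Xi (evalg 0%R%:i01 @^-1` [set x]) = 1.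
  by have := Xi0 _ cx; rewrite /marginal /pushforward diracE mem_set.
have e1 : Xi (evalg 1%R%:i01 @^-1` A) = 1.
  have := Xi1 _ mA; rewrite /marginal /pushforward => ->.
  by rewrite normalized_restr_self ?A_gt0.
have mx0 : measurable (evalg 0%R%:i01 @^-1` [set x] : set (borel (geo X))).
  exact: measurable_evalg.
have mx1 : measurable (evalg 1%R%:i01 @^-1` A : set (borel (geo X))).
  exact: measurable_evalg.
have mxt := @measurable_evalg R X (Itv01 t0 t1) _ mB.
apply/eqP; rewrite eq_le probability_le1//=.
rewrite -[leLHS](_ : Xi (evalg 0%R%:i01 @^-1` [set x] `&`
                         evalg 1%R%:i01 @^-1` A) = 1).
  apply: le_measure; rewrite ?inE//; first exact: measurableI.
  move=> g [/= g0 g1]; apply: (AB _ _ g1).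
    by rewrite -g0 (mdist_evalgl g).
  by rewrite -g0 (mdist_evalgr g).
exact: (probability_setI1 mx0 mx1 e0 e1).
Qed.
End contraction.

(** * Volumes of bounded sets *)

Section lipschitz.
Context (R : realType) (X : completeMetricType R).

Definition lipschitz1 (f : X -> R) := forall x y, f x - f y <= mdist x y.

Lemma lipschitz1_continuous f : lipschitz1 f -> continuous f.
Proof.
move=> fL x; apply/cvgrPdist_lt => e e0.
have : nbhs x (ball x e) by exact: nbhsx_ballx.
apply: filterS => y; rewrite ballEmdist /= => xy.
apply: le_lt_trans xy; rewrite ler_norml; apply/andP; split => //.
by have := fL y x; rewrite metric_sym; lra.
Qed.

Lemma lipschitz1_mdist (z : X) : lipschitz1 (mdist z).
Proof.
by move=> x y; have := metric_triangle z y x; rewrite (metric_sym y); lra.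
Qed.

Lemma measurable_sublevel f c : lipschitz1 f ->
  measurable ([set y | f y <= c] : set (borel X)).
Proof.
move=> /lipschitz1_continuous fc; rewrite -[X in measurable X]setCK.
apply: measurableC; apply: sub_sigma_algebra; apply: closed_openC.
rewrite (_ : [set y | f y <= c] = f @^-1` [set z | z <= c])//.
by apply: closed_comp => [y _|]; [exact: fc|exact: closed_le].
Qed.

Lemma measurable_superlevel f c : lipschitz1 f ->
  measurable ([set y | c <= f y] : set (borel X)).
Proof.
move=> fL; rewrite (_ : [set y | c <= f y] = [set y | - f y <= - c]); last first.
  by apply/funext => y /=; rewrite lerN2.
by apply: measurable_sublevel => x y; have := fL y x; rewrite metric_sym; lra.
Qed.

Lemma measurable_strict_sublevel f c : lipschitz1 f ->
  measurable ([set y | f y < c] : set (borel X)).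
Proof.
move=> fL; rewrite (_ : [set y | f y < c] = ~` [set y | c <= f y]).
  by apply: measurableC; exact: measurable_superlevel.
by apply/funext => y /=; rewrite ltNge; apply/propext; split => /negP.
Qed.
End lipschitz.

Section volume.
Context (R : realType) (X : completeMetricType R)
  (m : {measure set (borel X) -> \bar R}).
Context (fin : finite_on_bounded m).

(** The sets to which finite_on_bounded gives a finite volume. *)
Definition region (S : set X) := measurable (S : set (borel X)) /\
  exists (x : X) (r : R), S `<=` [set y | mdist x y <= r].

(** Only volumes of regions are compared, so that they can be taken in R. *)
Definition vol (S : set X) : R := fine (m S).

Lemma region_sub S T : region T -> measurable (S : set (borel X)) -> S `<=` T ->
  region S.
Proof.
by move=> [_ [x [r Tr]]] mS ST; split => //; exists x, r; exact: subset_trans Tr.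
Qed.

Lemma region_cball x r : region [set y | mdist x y <= r].
Proof.
split; last by exists x, r.
by apply: measurable_sublevel; exact: lipschitz1_mdist.
Qed.

Lemma regionI S T : region S -> measurable (T : set (borel X)) ->
  region (S `&` T).
Proof.
move=> rS mT; apply: (region_sub rS); last by move=> ? [].
by apply: measurableI => //; exact: rS.1.
Qed.

Lemma regionU S T : region S -> region T -> region (S `|` T).
Proof.
move=> [mS [x [r Sr]]] [mT [y [s Ts]]]; split; first exact: measurableU.
exists x, (Num.max r (mdist x y + s)) => z [/Sr|/Ts] /=; rewrite le_max => h.
  by rewrite h.
by apply/orP; right; apply: (le_trans (metric_triangle x y z)); rewrite lerD2l.
Qed.

Lemma region_fin S : region S -> (m S < +oo)%E.
Proof.
move=> [mS [x [r Sr]]]; apply: fin => //; exists x, (r + 1).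
by apply: (subset_trans Sr) => y /=; rewrite ballEmdist /= => ?; lra.
Qed.

Lemma volE S : region S -> m S = (vol S)%:E.
Proof.
by move=> rS; rewrite /vol fineK// ge0_fin_numE// region_fin.
Qed.

Lemma vol_ge0 S : 0 <= vol S.
Proof. by rewrite fine_ge0. Qed.

Lemma vol_le S T : region S -> region T -> S `<=` T -> vol S <= vol T.
Proof.
move=> rS rT ST; rewrite -lee_fin -!volE//.
by apply: le_measure; rewrite ?inE; [exact: rS.1|exact: rT.1|].
Qed.

Lemma volU S T : region S -> region T -> S `&` T = set0 ->
  vol (S `|` T) = vol S + vol T.
Proof.
move=> rS rT ST; apply: EFin_inj; rewrite EFinD -!volE//; last exact: regionU.
by rewrite measureU//; [exact: rS.1|exact: rT.1].
Qed.

Lemma volU_le S T : region S -> region T -> vol (S `|` T) <= vol S + vol T.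
Proof.
move=> rS rT; rewrite -lee_fin EFinD -!volE//; last exact: regionU.
by apply: measureU2; [exact: rS.1|exact: rT.1].
Qed.

Lemma vol_cball_gt0 x r : supp m = setT -> 0 < r ->
  0 < vol [set y | mdist x y <= r].
Proof.
move=> sm r0; have : supp m x by rewrite sm.
move=> /(_ (ball x r)) h; rewrite -lte_fin -volE; last exact: region_cball.
have ob : open (ball x r).
  rewrite ballEmdist; have := @open_comp _ _ (mdist x) [set z | z < r].
  apply; last exact: open_lt.
  by move=> y _; apply: lipschitz1_continuous; exact: lipschitz1_mdist.
apply: (lt_le_trans (h _)); first by split => //; exact: ballxx.
apply: le_measure; rewrite ?inE;
  [exact: sub_sigma_algebra|exact: (region_cball _ _).1|].
by move=> y; rewrite ballEmdist /= => /ltW.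
Qed.

Lemma vol_nondecreasing_le (F : nat -> set X) (S : set X) (c : R) :
  region S -> (forall n, region (F n)) -> nondecreasing_seq F ->
  S `<=` \bigcup_n F n -> \bigcup_n F n `<=` S ->
  (\forall n \near \oo, vol (F n) <= c) -> vol S <= c.
Proof.
move=> rS rF ndF SF FS Fc.
have SE : S = \bigcup_n F n by apply/seteqP.
have : m \o F @ \oo --> m S.
  rewrite SE; apply: nondecreasing_cvg_mu => //.
    by move=> i; exact: (rF i).1.
  by rewrite -SE; exact: rS.1.
move=> cv; rewrite -lee_fin -volE// -(cvg_lim _ cv)//.
apply: lime_le; first by apply/cvg_ex; exists (m S).
by apply: filterS Fc => n; rewrite /= volE// lee_fin.
Qed.

Lemma vol_nonincreasing_ge (F : nat -> set X) (S : set X) (c : R) :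
  region S -> (forall n, region (F n)) -> nonincreasing_seq F ->
  \bigcap_n F n = S ->
  (forall n, c <= vol (F n)) -> c <= vol S.
Proof.
move=> rS rF niF FS Fc.
have : m \o F @ \oo --> m S.
  rewrite -FS; apply: nonincreasing_cvg_mu => //; first exact: region_fin.
    by move=> i; exact: (rF i).1.
  by rewrite FS; exact: rS.1.
move=> cv; rewrite -lee_fin -volE// -(cvg_lim _ cv)//.
apply: lime_ge; first by apply/cvg_ex; exists (m S).
by apply: nearW => n; rewrite /= volE// lee_fin.
Qed.

End volume.

(** * The Busemann function *)

Section busemann.
Context (R : realType) (X : completeMetricType R).
Context (gamma : R -> X) (ray : geodesic_ray gamma).
Let b := busemann gamma.

(* Extending t - d(x, gamma t) by its value at 0 makes it monotone on all of R;
   the limit at infinity is unchanged. *)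
Let ramp (x : X) (t : R) := Num.max t 0 - mdist x (gamma (Num.max t 0)).

Let ramp_nondecreasing x : nondecreasing_fun (ramp x).
Proof.
move=> s t st; rewrite /ramp; set s' := Num.max s 0; set t' := Num.max t 0.
have s'0 : 0 <= s' by rewrite le_max lexx orbT.
have t'0 : 0 <= t' by rewrite le_max lexx orbT.
have st' : s' <= t' by rewrite ge_max le_max st /= le_max lexx orbT.
have := metric_triangle x (gamma s') (gamma t').
by rewrite ray// ler0_norm ?subr_le0//; lra.
Qed.

Let ramp_ubound x : has_ubound (range (ramp x)).
Proof.
exists (mdist x (gamma 0)) => _ [t _ <-]; rewrite /ramp.
set t' := Num.max t 0; have t'0 : 0 <= t' by rewrite le_max lexx orbT.
have := metric_triangle (gamma 0) x (gamma t').
by rewrite ray// sub0r normrN ger0_norm// metric_sym; lra.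
Qed.

Let busemannE x : b x = sup (range (ramp x)).
Proof.
apply: cvg_lim => //.
have := nondecreasing_cvgr (ramp_nondecreasing x) (ramp_ubound x).
apply: cvg_trans; apply: near_eq_cvg; near=> t.
have t0 : 0 <= t by near: t; apply: nbhs_pinfty_ge; rewrite num_real.
by rewrite /ramp (max_idPl t0).
Unshelve. all: by end_near. Qed.

Lemma busemann_ge x t : 0 <= t -> t - mdist x (gamma t) <= b x.
Proof.
move=> t0; rewrite busemannE.
apply: (sup_upper_bound (conj _ (ramp_ubound x))).
  by exists (ramp x 0), 0.
by exists t => //; rewrite /ramp (max_idPl t0).
Qed.

Lemma busemann_ramp_le x s t : 0 <= s -> s <= t ->
  s - mdist x (gamma s) <= t - mdist x (gamma t).
Proof.
move=> s0 st; have := ramp_nondecreasing x st.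
by rewrite /ramp !max_l//; exact: le_trans st.
Qed.

Lemma busemann_adherent x e : 0 < e ->
  exists T, 0 <= T /\ forall t, T <= t -> b x - e <= t - mdist x (gamma t).
Proof.
move=> e0; rewrite busemannE.
have [|_ [T _ <-] /ltW eT] := sup_adherent e0 (_ : has_sup (range (ramp x))).
  by split; [exists (ramp x 0), 0|exact: ramp_ubound].
exists (Num.max T 0); split=> [|t]; first by rewrite le_max lexx orbT.
rewrite ge_max => /andP[Tt t0]; apply: (le_trans eT).
by apply: (le_trans (ramp_nondecreasing x Tt)); rewrite /ramp (max_idPl t0).
Qed.

Lemma busemann_lipschitz : lipschitz1 b.
Proof.
move=> x y; apply/ler_addgt0Pl => e e0.
have [T [T0 /(_ T (lexx T))]] := busemann_adherent x e0.
have := busemann_ge y T0; have := metric_triangle y x (gamma T).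
by rewrite (metric_sym y x); lra.
Qed.

Lemma busemann_ray s : 0 <= s -> b (gamma s) = s.
Proof.
move=> s0; apply/eqP; rewrite eq_le; apply/andP; split; last first.
  by have := busemann_ge (gamma s) s0; rewrite mdistxx; lra.
apply/ler_addgt0Pl => e e0.
have [T [T0 /(_ (Num.max s T))]] := busemann_adherent (gamma s) e0.
rewrite le_max lexx orbT => /(_ isT).
have sT : s <= Num.max s T by rewrite le_max lexx.
by rewrite ray// ?ler0_norm ?subr_le0//; [lra|exact: le_trans sT].
Qed.

(** Going a distance s towards a remote point of the ray raises b by almost s:
    the gain is exact for the approximant t - d(x, gamma t) of b, which is below
    b at the new point and close to b at the old one. *)
Lemma busemann_ascent (gX : geodesic_space X) x s e : 0 <= s -> 0 < e ->
  exists y, mdist x y = s /\ b x + s - e <= b y <= b x + s.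
Proof.
move=> s0 e0; have [T [T0 hT]] := busemann_adherent x e0.
pose t := T + s + mdist x (gamma 0) + e.
have d0 := mdist_ge0 x (gamma 0).
have t0 : 0 <= t by rewrite /t; lra.
have Tt : T <= t by rewrite /t; lra.
have bt := hT _ Tt.
have sd : 0 <= s <= mdist x (gamma t).
  rewrite s0 /=; have := metric_triangle (gamma 0) x (gamma t).
  by rewrite ray// sub0r normrN ger0_norm// (metric_sym (gamma 0)) /t; lra.
have [y [xy yt]] := geodesic_point gX sd.
exists y; split=> //; have := busemann_ge y t0; rewrite yt => by_.
by have := busemann_lipschitz y x; rewrite metric_sym xy; lra.
Qed.

End busemann.

(** * Volume is carried upwards along the Busemann function *)

Section slabs.
Context (R : realType) (N : R) (N1 : 1 <= N) (X : completeMetricType R)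
  (m : {measure set (borel X) -> \bar R}).
Context (fin : finite_on_bounded m) (mcpX : MCP0 m N).
Context (gamma : R -> X) (ray : geodesic_ray gamma).
Let b := busemann gamma.
Let p := gamma 0.

Lemma vol_contraction (x : X) (A B : set X) (t : R) :
  0 <= t <= 1 -> region A -> region B ->
  (forall a y, A a -> mdist x y = t * mdist x a ->
     mdist y a = (1 - t) * mdist x a -> B y) ->
  t `^ N * vol m A <= vol m B.
Proof.
move=> t01 rA rB AB; rewrite -lee_fin EFinM -!(volE fin)//.
apply: (mcp_contraction mcpX t01 rA.1 rB.1) AB.
exact: region_fin.
Qed.

Definition slab (lo hi rho : R) : set X :=
  [set y | [/\ lo <= busemann gamma y, busemann gamma y <= hi &
               mdist (gamma 0) y <= rho]].

Lemma region_slab lo hi rho : region (slab lo hi rho).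
Proof.
have bL := busemann_lipschitz ray.
have -> : slab lo hi rho = [set y | mdist p y <= rho] `&`
    ([set y | lo <= b y] `&` [set y | b y <= hi]).
  apply/seteqP; split=> y; first by case.
  by case=> /= ? [].
apply: regionI; first exact: region_cball.
by apply: measurableI; [exact: measurable_superlevel|exact: measurable_sublevel].
Qed.

(* Contraction to gamma n by the factor 1 - s / n. The heights b are only
   controlled through their approximants at gamma n, so the contraction is
   applied to the sets F n of points where these are within eta / 2 of b; the
   F n exhaust the slab. The factor kappa absorbs (1 - s / n)^N. *)
Let vol_slab_shift_approx lo hi rho s eta kappa : 0 <= s -> 0 < eta ->
  0 < kappa < 1 -> kappa * vol m (slab lo hi rho) <=
    vol m (slab (lo + s - eta) (hi + s + eta) (rho + s + eta)).
Proof.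
move=> s0 eta0 /andP[k0 k1]; set B := slab (_ - _) _ _; set A := slab _ _ _.
have rB : region B by exact: region_slab.
have rA : region A by exact: region_slab.
rewrite mulrC -ler_pdivlMr//.
pose F (n : nat) : set X := A `&`
  [set y | b y - eta / 2 <= n%:R - mdist y (gamma n%:R)].
have rF n : region (F n).
  apply: regionI => //.
  (* halving makes the sum of two 1-Lipschitz functions 1-Lipschitz *)
  rewrite (_ : [set y | _] = [set y | (b y + mdist (gamma n%:R) y) / 2 <=
    (n%:R + eta / 2) / 2]); last first.
    apply/funext => y /=; apply/propext; rewrite (metric_sym y).
    by rewrite ler_pM2r//; split; lra.
  apply: measurable_sublevel => x y.
  have := busemann_lipschitz ray x y; have := lipschitz1_mdist (gamma n%:R) x y.
  by rewrite -/b; lra.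
apply: (vol_nondecreasing_le fin rA rF).
- move=> i j ij; apply/subsetPset => y [Ay /= By]; split=> //=.
  apply: (le_trans By); apply: (busemann_ramp_le ray) => //.
  by rewrite ler_nat.
- move=> y Ay.
  have [T [T0 hT]] : exists T, 0 <= T /\ forall t, T <= t ->
      b y - eta / 2 <= t - mdist y (gamma t).
    by apply: busemann_adherent => //; rewrite divr_gt0.
  exists (Num.truncn T).+1 => //; split=> //=.
  by apply: hT; apply/ltW/truncnS_gt.
- by move=> y [n _ []].
pose t0 := kappa `^ N^-1.
have N0 : 0 < N := lt_le_trans ltr01 N1.
have t00 : 0 < t0 by rewrite powR_gt0.
have t0N : t0 `^ N = kappa by rewrite -powRrM mulVf ?gt_eqF// powRr1// ltW.
have t01 : t0 < 1.
  rewrite ltNge; apply/negP => t01.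
  have : 1 `^ N <= t0 `^ N.
    by apply: ge0_ler_powR => //; rewrite ?nnegrE; lra.
  by rewrite powR1 t0N; lra.
near=> n.
rewrite ler_pdivlMr// mulrC.
have n0 : (0 < n%:R :> R).
  by rewrite ltr0n; near: n; exists 1%N.
have nt : s / (1 - t0) <= n%:R by near: n; exact: nbhs_infty_ger.
have nr : 2 * s * `|rho| / eta <= n%:R by near: n; exact: nbhs_infty_ger.
(* q * D below is the distance by which a point moves; as D is within rho of n,
   it is within eta / 2 of s *)
pose q : R := s / n%:R; have qn : q * n%:R = s by rewrite /q divfK// gt_eqF.
have q0 : 0 <= q by rewrite divr_ge0// ltW.
have qt : t0 <= 1 - q.
  suff : q <= 1 - t0 by lra.
  by rewrite /q ler_pdivrMr// mulrC -ler_pdivrMr// subr_gt0.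
have qr : q * `|rho| <= eta / 2.
  rewrite /q mulrAC ler_pdivrMr//.
  by move: nr; rewrite ler_pdivrMr//; lra.
apply: (@le_trans _ _ ((1 - q) `^ N * vol m (F n))).
  apply: ler_wpM2r; first exact: vol_ge0.
  by rewrite -t0N; apply: ge0_ler_powR; rewrite ?nnegrE; lra.
apply: (@vol_contraction (gamma n%:R)) => //; first by apply/andP; split; lra.
move=> a y [[la ha ra] /= ba].
set D := mdist (gamma n%:R) a => yD aD; rewrite -/b in la ha; rewrite -/p in ra.
rewrite (metric_sym a) -/D in ba.
have aD' : mdist y a = q * D by rewrite aD; ring.
have r0 : 0 <= rho by apply: le_trans ra; exact: mdist_ge0.
rewrite (ger0_norm r0) in qr.
have pn : mdist p (gamma n%:R) = n%:R.
  by rewrite ray// sub0r normrN ger0_norm// ltW.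
have nD : q * D <= s + q * rho.
  rewrite -qn -mulrDr ler_wpM2l// -pn.
  have := metric_triangle (gamma n%:R) p a.
  by rewrite (metric_sym _ p) -/D; lra.
have Dn : s - q * rho <= q * D.
  rewrite -qn -mulrBr ler_wpM2l//.
  have := metric_triangle p a (gamma n%:R).
  by rewrite pn (metric_sym a (gamma _)) -/D; lra.
have := busemann_ge ray y (ltW n0); rewrite (metric_sym y) yD -/b => by1.
have := busemann_lipschitz ray y a; rewrite -/b aD' => by2.
split; rewrite -?/b; [lra|lra|].
by have := metric_triangle p a y; rewrite (metric_sym a y) aD' -/p; lra.
Unshelve. all: by end_near. Qed.

(** Volume does not decrease along b. This is where the contraction centres
    escape to infinity, so that no factor depending on N remains. *)
Lemma vol_slab_shift lo hi rho s : 0 <= s ->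
  vol m (slab lo hi rho) <= vol m (slab (lo + s) (hi + s) (rho + s)).
Proof.
move=> s0.
have approx eta : 0 < eta -> vol m (slab lo hi rho) <=
    vol m (slab (lo + s - eta) (hi + s + eta) (rho + s + eta)).
  move=> eta0; rewrite leNgt; apply/negP; set V := vol m (slab lo _ _).
  set V' := vol m _ => VV'; have V'0 : 0 <= V' by exact: vol_ge0.
  have V0 : 0 < V := le_lt_trans V'0 VV'.
  (* kappa * V is then the midpoint of V' and V *)
  have := @vol_slab_shift_approx lo hi rho s eta ((V' + V) / (2 * V)) s0 eta0.
  rewrite -/V -/V' (_ : (V' + V) / (2 * V) * V = (V' + V) / 2); last first.
    by field; rewrite gt_eqF.
  have : 0 < (V' + V) / (2 * V) < 1.
    by rewrite divr_gt0 ?addr_ge0_gt0 ?mulr_gt0 ?ltr_pdivrMr//; lra.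
  by move=> h /(_ h); lra.
pose F n := slab (lo + s - n.+1%:R^-1) (hi + s + n.+1%:R^-1)
  (rho + s + n.+1%:R^-1).
apply: (@vol_nonincreasing_ge _ _ _ fin F) => //; try exact: region_slab.
- by move=> n; exact: region_slab.
- move=> i j ij; apply/subsetPset => y; rewrite /F => -[y1 y2 y3].
  have ji : j.+1%:R^-1 <= i.+1%:R^-1 :> R by rewrite lef_pV2 ?posrE// ler_nat.
  move: y1 y2 y3 ji; move: (i.+1%:R^-1) (j.+1%:R^-1) => ei ej y1 y2 y3 ji.
  by split; lra.
- apply/seteqP; split=> [y Fy|y [y1 y2 y3] n _].
    have small e : 0 < e -> exists n, n.+1%:R^-1 <= e :> R.
      move=> e0; exists (Num.truncn e^-1).
      by rewrite invf_ple ?posrE// ltW// truncnS_gt.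
    split; apply/ler_addgt0Pr => e /small[n ne]; have [] := Fy n I.
    - by move: (n.+1%:R^-1) ne => en; lra.
    - by move: (n.+1%:R^-1) ne => en; lra.
    - by move: (n.+1%:R^-1) ne => en; lra.
  have n0 : 0 < n.+1%:R^-1 :> R by rewrite invr_gt0.
  by rewrite /F; move: (n.+1%:R^-1) n0 => en n0; split; lra.
- by move=> n; apply: approx; rewrite invr_gt0.
Qed.
End slabs.

(** * Volume of slabs under linear growth *)

Section growth.
Context (R : realType) (N : R) (N1 : 1 <= N) (X : completeMetricType R)
  (m : {measure set (borel X) -> \bar R}).
Context (gX : geodesic_space X) (fin : finite_on_bounded m)
  (sm : supp m = setT) (mcpX : MCP0 m N).
Context (gamma : R -> X) (ray : geodesic_ray gamma).

(** A step w larger than the height of the slab makes its n translates pairwise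
    disjoint, and each has at least the volume of the slab. *)
Lemma vol_slab_stack lo hi rho w (n : nat) : 0 < w -> hi - lo < w ->
  n%:R * vol m (slab gamma lo hi rho) <=
    vol m [set y | mdist (gamma 0) y <= rho + n%:R * w].
Proof.
move=> w0 hw; have bL := busemann_lipschitz ray.
pose S (k : nat) : set X := [set y | mdist (gamma 0) y <= rho + k%:R * w] `&`
  [set y | busemann gamma y < lo + k%:R * w].
have rS k : region (S k).
  by apply: regionI; [exact: region_cball|exact: measurable_strict_sublevel].
apply: (@le_trans _ _ (vol m (S n))); last first.
  by apply: (vol_le fin) => //; [exact: region_cball|move=> y []].
elim: n => [|n IH]; first by rewrite mul0r; exact: vol_ge0.
pose C := slab gamma (lo + n%:R * w) (hi + n%:R * w) (rho + n%:R * w).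
have rC : region C by exact: region_slab.
have nw0 : 0 <= n%:R * w by rewrite mulr_ge0// ltW.
have nw : n.+1%:R * w = n%:R * w + w by rewrite -natr1 mulrDl mul1r.
apply: (@le_trans _ _ (vol m (S n `|` C))).
  rewrite (volU fin)//; last first.
    by apply/seteqP; split=> // y [[_ /= yn] [yl _ _]]; lra.
  rewrite -natr1 mulrDl mul1r; apply: lerD => //.
  exact: (vol_slab_shift N1 fin mcpX ray).
apply: (vol_le fin) => //; first exact: regionU.
by move=> y [[/= yr yb]|[yl yh yr]]; split; rewrite /= nw; lra.
Qed.

(** The slab contains the ball of radius 1/2 about gamma(1/2). *)
Lemma vol_slab01_gt0 : 0 < vol m (slab gamma 0 1 1).
Proof.
have h0 : (0 <= 2^-1 :> R) by rewrite invr_ge0.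
apply: (@lt_le_trans _ _ (vol m [set y | mdist (gamma 2^-1) y <= 2^-1])).
  by apply: vol_cball_gt0 => //; rewrite invr_gt0.
apply: (vol_le fin); [exact: region_cball|exact: region_slab|].
move=> y /= yr.
have bL := busemann_lipschitz ray; have bg := busemann_ray ray h0.
have := bL y (gamma 2^-1); have := bL (gamma 2^-1) y.
have := metric_triangle (gamma 0) (gamma 2^-1) y.
rewrite ray// sub0r normrN ger0_norm// (metric_sym y) bg.
by move: yr; set d := mdist _ _ => *; split; lra.
Qed.

Lemma vol_cball_ge_linear r : 6 <= r ->
  vol m (slab gamma 0 1 1) * r / 4 <= vol m [set y | mdist (gamma 0) y <= r].
Proof.
move=> r6; pose n := Num.truncn ((r - 1) / 2).
have n0 : 0 <= (r - 1) / 2 by lra.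
have /andP[nl nh] := truncn_itv n0; rewrite -/n in nl nh.
rewrite -[n.+1%:R]natr1 in nh.
have w0 : 0 < 2 :> R by lra.
have hw : 1 - 0 < 2 :> R by lra.
have h := vol_slab_stack 1 n w0 hw.
have V0 := vol_slab01_gt0.
apply: le_trans (le_trans h _).
  rewrite -mulrA mulrC ler_pM2r//; lra.
apply: (vol_le fin); [exact: region_cball|exact: region_cball|].
by move=> y /= yr; lra.
Qed.

Context (K r0 : R)
  (growth : forall r, r0 <= r ->
     vol m [set y | mdist (gamma 0) y <= r] <= K * r).

(** Otherwise stacking with step 2 would fill the balls about p faster than
    linearly at rate K. *)
Lemma vol_slab_bounded a rho : vol m (slab gamma a (a + 1) rho) <= 2 * K.
Proof.
rewrite leNgt; apply/negP; set V := vol m _ => KV.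
pose c := V - 2 * K; have c0 : 0 < c by rewrite /c; lra.
pose u := (`|K * rho| + 1) / c; pose z := u + `|rho| + `|r0|.
pose n := (Num.truncn z).+1.
have u0 : 0 <= u by apply: divr_ge0; [exact: addr_ge0|exact: ltW].
have zn : z <= n%:R by apply/ltW/truncnS_gt.
have rr := normr_ge0 rho; have r0r := normr_ge0 r0.
have rl := ler_norm (- rho); rewrite normrN in rl; have r0l := ler_norm r0.
have w0 : 0 < 2 :> R by lra.
have hw : a + 1 - a < 2 by lra.
have h := vol_slab_stack rho n w0 hw; rewrite -/V in h.
have : r0 <= rho + n%:R * 2 by move: zn; rewrite /z; lra.
move=> /growth /(le_trans h).
have kl := ler_norm (K * rho).
have : u <= n%:R by move: zn; rewrite /z; lra.
rewrite ler_pdivrMr// /c => nc nV.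
by move: nc nV kl; rewrite mulrBr mulrDr; lra.
Qed.

(** What a slab leaves outside the ball of radius sg about p. The outer radius
    rho only keeps the set bounded. The height interval is half-open so that the
    case k = 0 is empty and the tails can be cut at intermediate heights. *)
Definition slab_tail a k sg rho : set X :=
  slab gamma a (a + k) rho `&`
    ([set y | busemann gamma y < a + k] `&` [set y | sg < mdist (gamma 0) y]).

Lemma region_slab_tail a k sg rho : region (slab_tail a k sg rho).
Proof.
apply: regionI; first exact: region_slab.
apply: measurableI.
  by apply: measurable_strict_sublevel; exact: busemann_lipschitz.
rewrite (_ : [set y | _] = ~` [set y | mdist (gamma 0) y <= sg]).
  by apply: measurableC; apply: measurable_sublevel; exact: lipschitz1_mdist.
by apply/funext => y /=; rewrite ltNge; apply/propext; split => /negP.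
Qed.

(** A unit slab piece at height a0 and radius rho0 that is e-close to the
    supremum of the volumes keeps its volume when shifted to height a, where it
    stays within rho0 + (a - a0) of p. Together with the tail beyond that radius
    it cannot exceed the supremum, so the tail has volume at most e; k unit
    tails are then added up. *)
Lemma vol_slab_tail_small e : 0 < e -> exists a0 rho0,
  forall a (k : nat) sg rho, a0 <= a -> rho0 + (a + k%:R - a0) <= sg ->
    vol m (slab_tail a k%:R sg rho) <= k%:R * e.
Proof.
move=> e0.
pose E : set R := [set v | exists a rho, v = vol m (slab gamma a (a + 1) rho)].
have supE : has_sup E.
  split; first by exists (vol m (slab gamma 0 (0 + 1) 0)), 0, 0.
  by exists (2 * K) => _ [a [rho ->]]; exact: vol_slab_bounded.
have [_ [a0 [rho0 ->]] Ve] := sup_adherent e0 supE.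
exists a0, rho0.
have unit_tail a sg rho : a0 <= a -> rho0 + (a - a0) <= sg ->
    vol m (slab_tail a 1 sg rho) <= e.
  move=> a0a sgl.
  pose core := slab gamma (a0 + (a - a0)) (a0 + 1 + (a - a0)) (rho0 + (a - a0)).
  have rc : region core by exact: region_slab.
  have rT := region_slab_tail a 1 sg rho.
  have cl : vol m (slab gamma a0 (a0 + 1) rho0) <= vol m core.
    by apply: (vol_slab_shift N1 fin mcpX ray); lra.
  have : vol m (core `|` slab_tail a 1 sg rho) <= sup E.
    apply: (@le_trans _ _ (vol m (slab gamma a (a + 1) (Num.max rho sg)))).
      apply: (vol_le fin); [exact: regionU|exact: region_slab|].
      move=> y [[yl yh yr]|[[yl yh yr] _]]; (split; [lra|lra|]); rewrite le_max.
        by apply/orP; right; lra.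
      by rewrite yr.
    apply: (sup_upper_bound supE).
    by exists a, (Num.max rho sg).
  rewrite (volU fin)//; first by lra.
  apply/seteqP; split=> // y [[yl yh yr] [_ [_ /= ysg]]]; lra.
move=> a k sg rho a0a; elim: k sg => [|k IH] sg sgl.
  rewrite mul0r (_ : slab_tail _ _ _ _ = set0); first by rewrite /vol measure0.
  by apply/seteqP; split=> // y [[/= yl _ _] [/= yh _]]; lra.
have k0 : 0 <= k%:R :> R by [].
rewrite -natr1 in sgl *.
apply: (@le_trans _ _ (vol m (slab_tail a k%:R sg rho `|`
                              slab_tail (a + k%:R) 1 sg rho))).
  apply: (vol_le fin);
    [exact: region_slab_tail|apply: regionU; exact: region_slab_tail|].
  move=> y [[yl yh yr] [/= yb ysg]].
  have [yk|yk] := ltP (busemann gamma y) (a + k%:R).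
    by left; split=> //; split => //; exact: ltW.
  by right; split; [split=> //; lra|split => //=; lra].
apply: le_trans (volU_le fin _ _) _; try exact: region_slab_tail.
rewrite mulrDl mul1r; apply: lerD; first by apply: IH; lra.
by apply: unit_tail; lra.
Qed.

End growth.

(** * The distance to the origin of the ray on high levels *)

Section drift.
Context (R : realType) (N : R) (N1 : 1 <= N) (X : completeMetricType R)
  (m : {measure set (borel X) -> \bar R}).
Context (gX : geodesic_space X) (fin : finite_on_bounded m)
  (sm : supp m = setT) (mcpX : MCP0 m N).
Context (gamma : R -> X) (ray : geodesic_ray gamma).
Context (K r0 : R)
  (growth : forall r, r0 <= r ->
     vol m [set y | mdist (gamma 0) y <= r] <= K * r).

Definition drift x := mdist (gamma 0) x - busemann gamma x.

(** The ball of radius L = delta * r about x is compared with the tails at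
    heights between r - L and r + L. It reaches down to distance d(p,x) - L
    >= r + 2 L from p, while the tail used starts at r + 3 L / 2, so the
    ball is contained in it and has volume at most about 2 L e. The constant
    22 comes from d(p,x) <= 11 r: the ball of radius r about p is contained
    in the ball of radius 22 r about x. *)
Lemma drift_gap delta : 0 < delta <= 3^-1 -> exists R0, 1 <= R0 /\ forall x,
  R0 <= busemann gamma x -> 3 * delta * busemann gamma x <= drift x ->
  drift x <= 10 * busemann gamma x -> False.
Proof.
move=> /andP[d0 d1].
pose theta := (delta / 22) `^ N.
have theta0 : 0 < theta by rewrite powR_gt0 ?divr_gt0.
pose f := vol m (slab gamma 0 1 1); have f0 : 0 < f by exact: vol_slab01_gt0.
(* the lower bound for the volume will be 2 * (r * e), the upper one r * e *)
pose e := theta * f / 8; have e0 : 0 < e by rewrite divr_gt0 ?mulr_gt0.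
have [a0 [rho0 tail]] := vol_slab_tail_small N1 fin mcpX ray growth e0.
pose u := (1 + 2 * (`|rho0| + 1 + `|a0|)) / delta.
have u0 : 0 <= u by apply: divr_ge0; [rewrite ?addr_ge0 ?mulr_ge0|exact: ltW].
have rhol := ler_norm rho0; have a0l := ler_norm a0.
have a0l' := ler_norm (- a0); rewrite normrN in a0l'.
have rhon := normr_ge0 rho0; have a0n := normr_ge0 a0.
exists (6 + u + 2 * `|a0|); split; first lra.
move=> x; set r := busemann gamma x => rl El Eh.
have r6 : 6 <= r by lra.
have ur : u <= r by lra.
have dr : 1 + 2 * (`|rho0| + 1 + `|a0|) <= delta * r.
  by move: ur; rewrite /u ler_pdivrMr// [r * _]mulrC.
pose L := delta * r; rewrite -/L in dr.
have Lr : L <= r / 3.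
  by rewrite /L mulrC; apply: ler_wpM2l => //; lra.
have L0 : 0 < L by lra.
set D := mdist (gamma 0) x.
have DE : D = r + drift x by rewrite /drift -/r -/D; ring.
have L3 : 3 * L <= drift x by move: El; rewrite /L -mulrA.
have lower : theta * (f * r / 4) <= vol m [set y | mdist x y <= L].
  apply: (@le_trans _ _ (theta * vol m [set y | mdist x y <= 22 * r])).
    rewrite ler_pM2l//.
    apply: (le_trans (vol_cball_ge_linear N1 fin sm mcpX ray r6)).
    apply: (vol_le fin); [exact: region_cball|exact: region_cball|].
    move=> y /= yr; have := metric_triangle x (gamma 0) y.
    by rewrite (metric_sym x (gamma 0)) -/D DE; lra.
  apply: (vol_contraction fin mcpX (x := x));
    [|exact: region_cball|exact: region_cball|].
    by apply/andP; split; [apply: divr_ge0 => //; exact: ltW|lra].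
  move=> a y /= ar -> _.
  rewrite (_ : L = delta / 22 * (22 * r)); last by rewrite /L; field.
  by rewrite ler_pM2l// divr_gt0.
pose k := (Num.truncn (2 * L)).+1.
have L2 : 0 <= 2 * L by lra.
have /andP[kl kh] := truncn_itv L2; rewrite -/k in kh.
have kE : k%:R = (Num.truncn (2 * L))%:R + 1 :> R by rewrite natr1.
have upper : vol m [set y | mdist x y <= L] <= k%:R * e.
  apply: le_trans (tail (r - L) k (r + L + L / 2) (D + L) _ _); try lra.
  apply: (vol_le fin); [exact: region_cball|exact: region_slab_tail|].
  move=> y /= yL.
  have bL := busemann_lipschitz ray.
  have := bL x y; have := bL y x; rewrite (metric_sym y x) -/r => by1 by2.
  have := metric_triangle (gamma 0) x y; have := metric_triangle (gamma 0) y x.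
  rewrite (metric_sym y x) -/D => dy1 dy2.
  by split; [split; lra|split => /=; lra].
have kr : k%:R <= r by lra.
have : k%:R * e <= r * e by rewrite ler_pM2r.
have re : 0 < r * e by rewrite mulr_gt0//; lra.
move: lower; rewrite (_ : theta * (f * r / 4) = 2 * (r * e)); last first.
  by rewrite /e; field.
by lra.
Qed.

(** The range of drift between 3 delta b and 10 b is excluded by drift_gap. A
    point with more drift is raised by s = drift x / 4: its drift is then
    between 2 s and 4 s + 1 and its height between s and 7 s / 5, that is, in
    the excluded range. *)
Lemma drift_sublinear delta : 0 < delta <= 3^-1 ->
  exists R0, 1 <= R0 /\ forall x, R0 <= busemann gamma x ->
    drift x < 3 * delta * busemann gamma x.
Proof.
move=> d01; have [R0 [R01 gap]] := drift_gap d01.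
move/andP: d01 => [d0 d1].
exists R0; split=> // x xR; rewrite ltNge; apply/negP => El.
have [Eh|Eh] := leP (drift x) (10 * busemann gamma x); first exact: (gap x).
pose s := drift x / 4; have s1 : 1 <= s by rewrite /s; lra.
have [y [xy /andP[yl yh]]] :=
  busemann_ascent ray gX x (le_trans ler01 s1) ltr01.
have := metric_triangle (gamma 0) x y; have := metric_triangle (gamma 0) y x.
rewrite (metric_sym y x) xy.
have sE : drift x = 4 * s by rewrite /s; field.
move: sE (gap y); rewrite /drift => sE gapy t1 t2.
rewrite /drift sE in Eh.
apply: gapy; [lra| |lra].
have b0 : 0 <= busemann gamma y by lra.
apply: (@le_trans _ _ (busemann gamma y)); last by lra.
by rewrite ler_piMl//; lra.
Qed.

End drift.

(** * Compactness of closed bounded sets *)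

Section properness.
Context (R : realType) (N : R) (X : completeMetricType R)
  (m : {measure set (borel X) -> \bar R}).
Context (fin : finite_on_bounded m) (sm : supp m = setT) (mcpX : MCP0 m N).

(** Without a finite net, an e-separated sequence could be extended for ever.
    The balls of radius e / 3 about its points are disjoint and contained in one
    ball, and by contraction each has volume at least c > 0. *)
Lemma cball_finite_net (x : X) r e : 0 < e ->
  exists s : seq X, [set y | mdist x y <= r] `<=`
    [set y | exists2 z, z \in s & mdist z y < e].
Proof.
move=> e0; have [r_neg|r0] := ltP r 0.
  by exists [::] => y /= yr; have := mdist_ge0 x y; lra.
pose r1 := r + e; pose t := e / 3 / (2 * r1).
have r10 : 0 < r1 by rewrite /r1; lra.
have t01 : 0 <= t <= 1.
  apply/andP; split; first by rewrite !divr_ge0// ?mulr_ge0// ltW.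
  by rewrite /t ler_pdivrMr ?mulr_gt0// mul1r /r1; lra.
pose B := [set y | mdist x y <= r1].
have rB : region B by exact: region_cball.
have B0 : 0 < vol m B by exact: vol_cball_gt0.
pose c := t `^ N * vol m B.
have c0 : 0 < c.
  by rewrite mulr_gt0// powR_gt0// !divr_gt0// mulr_gt0.
have small_ball z : mdist x z <= r -> c <= vol m [set y | mdist z y <= e / 3].
  move=> zr.
  apply: (@le_trans _ _ (t `^ N * vol m [set y | mdist z y <= 2 * r1])).
    rewrite ler_wpM2l ?powR_ge0//.
    apply: (vol_le fin rB); first exact: region_cball.
    move=> y; rewrite /B /r1 /= => yr; have := metric_triangle z x y.
    by rewrite (metric_sym z x); lra.
  apply: (vol_contraction fin mcpX t01 (x := z));
    [exact: region_cball|exact: region_cball|].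
  move=> a y /= ar -> _; rewrite (_ : e / 3 = t * (2 * r1)).
    by rewrite ler_wpM2l//; case/andP: t01.
  by rewrite /t divfK// gt_eqF// mulr_gt0.
apply: contrapT => nonet.
pose U (s : seq X) : set X := [set y | exists2 z, z \in s & mdist z y <= e / 3].
have packing n : exists s : seq X, [/\ forall z, z \in s -> mdist x z <= r,
    region (U s) & n%:R * c <= vol m (U s)].
  elim: n => [|n [s [sr rU IH]]].
    exists [::]; split=> //; last by rewrite mul0r; exact: vol_ge0.
    rewrite (_ : U _ = set0); first by split => //; exists x, 0.
    by apply/seteqP; split => // y [].
  have [z zr zs] : exists2 z, mdist x z <= r &
      forall y, y \in s -> e <= mdist y z.
    apply: contrapT => noz; apply: nonet; exists s => z /= zr.
    apply: contrapT => zs; apply: noz; exists z => // y ys.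
    by rewrite leNgt; apply/negP => yz; apply: zs; exists y.
  have UE : U (z :: s) = [set y | mdist z y <= e / 3] `|` U s.
    apply/seteqP; split=> y; rewrite /U /=.
      by move=> [w]; rewrite inE => /orP[/eqP ->|ws] wy; [left|right; exists w].
    move=> [zy|[w ws wy]]; first by exists z; rewrite ?inE ?eqxx.
    by exists w; rewrite ?inE ?ws ?orbT.
  have rz : region [set y | mdist z y <= e / 3] by exact: region_cball.
  exists (z :: s); split; rewrite ?UE; last 2 first.
  - exact: regionU.
  - rewrite (volU fin)//; last first.
      apply/seteqP; split=> // y [/= zy [w ws wy]].
      have := zs w ws; have := metric_triangle w y z.
      by rewrite (metric_sym y z); lra.
    by rewrite -natr1 mulrDl mul1r addrC lerD// small_ball.
  by move=> w; rewrite inE => /orP[/eqP ->|/sr].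
pose n := (Num.truncn (vol m B / c)).+1.
have [s [sr rU]] := packing n; apply/negP; rewrite -ltNge.
apply: (@le_lt_trans _ _ (vol m B)).
  apply: (vol_le fin) => // y [z /sr zr zy]; rewrite /B /r1 /=.
  by have := metric_triangle x z y; lra.
by rewrite -ltr_pdivrMr// truncnS_gt.
Qed.

Lemma bounded_closed_compact (x : X) r (A : set X) :
  closed A -> A `<=` [set y | mdist x y <= r] -> compact A.
Proof.
move=> cA Ar; rewrite compact_ultra => F FU FA.
have FF : ProperFilter F by exact: ultra_proper.
have cauchyF : cauchy F.
  apply: cauchy_exP => e e0.
  have [s sA] := @cball_finite_net x r e e0.
  apply: contrapT => noball.
  have : F [set y | forall z, z \in s -> ~ ball z e y].
    elim: s {sA} => [|z s IH]; first by apply: filterS filterT.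
    have [Fz|Fz] := in_ultra_setVsetC (ball z e) FU.
      by case: noball; exists z.
    apply: filterS2 Fz IH => y zy sy w; rewrite inE => /orP[/eqP ->//|]; exact: sy.
  move=> Fs; have : F set0.
    apply: filterS2 FA Fs => y /Ar /sA [z zs zy] /(_ z zs).
    by rewrite ballEmdist; exact.
  exact: filter_not_empty.
have /cvg_ex[/= l Fl] : cvg F by exact: cauchy_cvg.
exists l; split=> //; rewrite (closure_id A).1// => B Bl.
have [y []] := filter_ex (filterI FA (Fl _ Bl)).
by exists y.
Qed.

End properness.

(** * Size of the level sets *)

Section level_sets.
Context (R : realType) (X : completeMetricType R).

Lemma limf_esup_pinfty_lt (f : R -> \bar R) (c : R) :
  (limf_esup f (pinfty_nbhs R) < c%:E)%E ->
  exists M, forall r, M < r -> (f r <= c%:E)%E.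
Proof.
move=> /ereal_inf_lt[_ [V [M [_ MV]] <-] Vc].
exists M => r /MV Vr; apply: ltW; apply: le_lt_trans Vc.
by apply: ereal_sup_ubound; exists r.
Qed.

Lemma limf_esup_pinfty_le (f : R -> \bar R) (c M : R) :
  (forall r, M < r -> (f r <= c%:E)%E) ->
  (limf_esup f (pinfty_nbhs R) <= c%:E)%E.
Proof.
move=> Mc; apply: ge_ereal_inf; exists (ereal_sup (f @` [set r | M < r])).
  by exists [set r | M < r] => //; exists M; rewrite num_real.
by apply: ge_ereal_sup => _ [r /Mc rc <-].
Qed.

Context (m : {measure set (borel X) -> \bar R}) (fin : finite_on_bounded m).

Lemma linear_volume_growth (x : X) (V0 : R) :
  limf_esup (fun r : R => m (ball x r) / r%:E)%E (pinfty_nbhs R) = V0%:E ->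
  exists K r0, forall r, r0 <= r -> vol m [set y | mdist x y <= r] <= K * r.
Proof.
move=> growth; have [M Mc] : exists M, forall r, M < r ->
    (m (ball x r) / r%:E <= (`|V0| + 1)%:E)%E.
  apply: limf_esup_pinfty_lt; rewrite growth lte_fin.
  by have := ler_norm V0; lra.
exists (2 * (`|V0| + 1)), (`|M| + 1) => r rM.
have Ml := ler_norm M; have Mn := normr_ge0 M; have Vn := normr_ge0 V0.
have r1 : 1 <= r by lra.
have := Mc (r + 1); rewrite (_ : M < r + 1); last lra.
move=> /(_ isT); rewrite inver gt_eqF; last lra.
rewrite lee_pdivrMr; last lra.
rewrite -EFinM => h.
have rb : region (ball x (r + 1)).
  rewrite ballEmdist; split; last by exists x, (r + 1) => y /= /ltW.
  by apply: measurable_strict_sublevel; exact: lipschitz1_mdist.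
have h2 : vol m (ball x (r + 1)) <= (`|V0| + 1) * (r + 1).
  by rewrite -lee_fin -(volE fin).
have h1 : vol m [set y | mdist x y <= r] <= vol m (ball x (r + 1)).
  apply: (vol_le fin) => //; first exact: region_cball.
  by rewrite ballEmdist => y /= yr; lra.
apply: (le_trans h1 (le_trans h2 _)).
by rewrite [2 * _]mulrC -mulrA; apply: ler_wpM2l; lra.
Qed.

Lemma diam_le (A : set X) (x : X) (r : R) :
  (forall y, A y -> mdist x y <= r) -> (diam A <= (2 * r)%:E)%E.
Proof.
move=> Ar; apply: ge_ereal_sup => _ [y Ay [z Az <-]].
rewrite lee_fin; have := metric_triangle y x z; have := Ar _ Ay; have := Ar _ Az.
by rewrite (metric_sym y x); lra.
Qed.

Context (N : R) (N1 : 1 <= N).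
Context (gX : geodesic_space X) (sm : supp m = setT) (mcpX : MCP0 m N).
Context (gamma : R -> X) (ray : geodesic_ray gamma).
Context (K r0 : R)
  (growth : forall r, r0 <= r ->
     vol m [set y | mdist (gamma 0) y <= r] <= K * r).

Lemma diam_level_le2 :
  (limf_esup (fun r : R => diam (busemann gamma @^-1` [set r]) / r%:E)%E
       (pinfty_nbhs R) <= 2%:E)%E.
Proof.
apply/lee_addgt0Pr => e e0; rewrite -EFinD.
pose delta := Num.min 3^-1 (e / 6).
have d01 : 0 < delta <= 3^-1.
  by rewrite lt_min invr_gt0 ltr0n divr_gt0//= ge_min lexx.
have de : delta <= e / 6 by rewrite ge_min lexx orbT.
have [R0 [R01 hR0]] := drift_sublinear N1 gX fin sm mcpX ray growth d01.
apply: (@limf_esup_pinfty_le _ _ R0) => r rR0.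
have rpos : 0 < r by lra.
rewrite inver gt_eqF// lee_pdivrMr// -EFinM.
apply: (@le_trans _ _ (2 * ((1 + e / 2) * r))%:E); last first.
  by rewrite lee_fin le_eqVlt; apply/orP; left; apply/eqP; field.
apply: (@diam_le _ (gamma 0)) => y /= yr.
have := hR0 y; rewrite yr /drift yr => /(_ (ltW rR0)) h.
have : 3 * delta * r <= e / 2 * r by rewrite ler_wpM2r; lra.
by lra.
Qed.

(** A point of height r is at bounded distance from some point of height at
    least R0, where drift_sublinear bounds the distance to p. *)
Lemma level_bounded (r : R) : exists rho,
  busemann gamma @^-1` [set r] `<=` [set y | mdist (gamma 0) y <= rho].
Proof.
have d01 : 0 < (3^-1 : R) <= 3^-1 by rewrite invr_gt0 ltr0n lexx.
have [R0 [R01 hR0]] := drift_sublinear N1 gX fin sm mcpX ray growth d01.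
pose s := `|R0 - r| + 1; have := ler_norm (R0 - r); have := normr_ge0 (R0 - r).
move=> n0 nl; have s0 : 0 <= s by rewrite /s; lra.
exists (2 * (r + s) + s) => x /= xr.
have [y [xy /andP[yl yh]]] := busemann_ascent ray gX x s0 ltr01.
rewrite xr in yl yh.
have yR0 : R0 <= busemann gamma y by apply: le_trans yl; rewrite /s; lra.
have := hR0 y yR0; rewrite /drift mulfV// mul1r => h.
by have := metric_triangle (gamma 0) y x; rewrite (metric_sym y x) xy; lra.
Qed.

Lemma level_compact (r : R) : compact (busemann gamma @^-1` [set r]).
Proof.
have [rho hrho] := level_bounded r.
apply: (bounded_closed_compact fin sm mcpX) hrho.
apply: closed_comp => [y _|]; last exact: closed_eq.
apply: lipschitz1_continuous; exact: busemann_lipschitz.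
Qed.

End level_sets.

Unset Implicit Arguments.
Local Open Scope ereal_scope.

Theorem theorem1p3 (R : realType) (N : R) (N1 : (1 <= N)%R)
  (X : completeMetricType R) (m : {measure set (borel X) -> \bar R})
  (mmsX : metric_measure_space m)
  (ncX : ~ compact [set: X])
  (nbX : nonbranching X)
  (mcpX : MCP0 m N)
  (gamma : R -> X) (ray : geodesic_ray gamma)
  (V0 : R)
  (growth : limf_esup (fun r : R => m (ball (gamma 0%R) r) / r%:E)
              (pinfty_nbhs R) = V0%:E) :
  (exists C0 : R, (C0 <= 2)%R /\
     limf_esup (fun r : R => diam (busemann gamma @^-1` [set r]) / r%:E)
       (pinfty_nbhs R) <= C0%:E) /\
  (forall r : R, compact (busemann gamma @^-1` [set r])).
Proof.
case: mmsX => _ gX _ fin sm.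
have [K [r0 volK]] := linear_volume_growth fin growth.
split.
  by exists 2%R; split => //; exact: (diam_level_le2 fin N1 gX sm mcpX ray volK).
exact: (level_compact fin N1 gX sm mcpX ray volK).
Qed.
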